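(* For every $m\ge 15$, the complete bipartite graph $K_{2,m}$ does not admit any empty-ply drawing.
   Context: A straight-line drawing of a graph places each vertex at a distinct point of the plane and draws each edge as the straight-line segment between its endpoints. For each vertex $v$, the ply-disk $D_v$ is the open disk centered at $v$ with radius equal to half the length of the longest edge incident to $v$. A drawing is empty-ply if every ply-disk $D_v$ contains no vertex other than $v$ in its interior. *)

(* Defs.v *)
From mathcomp Require Import all_boot all_order all_algebra.
From mathcomp Require Import classical_sets reals.

Set Implicit Arguments.
Unset Strict Implicit.
Unset Printing Implicit Defensive.

Import Order.TTheory GRing.Theory Num.Theory.

Local Open Scope classical_set_scope.
Local Open Scope ring_scope.

Record sgraph := SGraph {
  vertex :> finType;
  adj : rel vertex;
  adj_sym : symmetric adj;
  adj_irr : irreflexive adj }.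

Definition cbip_adj (n m : nat) : rel ('I_n + 'I_m)%type :=
  fun u v =>
    match u, v with
    | inl _, inr _ | inr _, inl _ => true
    | _, _ => false
    end.

Lemma cbip_adj_sym n m : symmetric (@cbip_adj n m).
Proof. by case=> i [] j. Qed.

Lemma cbip_adj_irr n m : irreflexive (@cbip_adj n m).
Proof. by case. Qed.

Definition complete_bipartite (n m : nat) : sgraph :=
  SGraph (@cbip_adj_sym n m) (@cbip_adj_irr n m).

(* The norm that MathComp-Analysis puts on R * R is the sup norm, hence an
   explicit Euclidean distance. *)
Definition edist (R : realType) (x y : R * R) : R :=
  Num.sqrt ((x.1 - y.1) ^+ 2 + (x.2 - y.2) ^+ 2).

(* A straight-line drawing is determined by its vertex positions: the edge uv
   is the segment from pos u to pos v, of length edist (pos u) (pos v). *)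
Record drawing (R : realType) (G : sgraph) := Drawing {
  pos :> G -> R * R;
  pos_inj : injective pos }.

(* Lengths are nonnegative, so the default value 0 of the maximum matters only
   for isolated vertices, whose disk is then empty. *)
Definition longest_edge (R : realType) (G : sgraph) (d : drawing R G) (v : G)
    : R :=
  \big[Num.max/0]_(u : G | adj v u) edist (d v) (d u).

Definition ply_disk (R : realType) (G : sgraph) (d : drawing R G) (v : G)
    : set (R * R) :=
  [set q | edist (d v) q < longest_edge d v / 2].

Definition empty_ply (R : realType) (G : sgraph) (d : drawing R G) : Prop :=
  forall v u : G, u != v -> ~ ply_disk d v (d u).

(* Main.v *)
Require Import Defs.
From Stdlib Require Import ZArith.
From mathcomp Require Import all_boot all_order all_algebra.
From mathcomp Require Import classical_sets reals.
From mathcomp Require Import ssrZ zify ring lra.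

Set Implicit Arguments.
Unset Strict Implicit.
Unset Printing Implicit Defensive.

Import Order.TTheory GRing.Theory Num.Theory.

(* Let [a], [b] be the two hubs, [d] their distance, and scale the drawing so
   that the longest edge at [a] has length 2 and the longest edge at [b] has
   length [l <= 2]; emptiness of the ply-disks of the hubs and of the leaves
   gives [1 <= d <= 4] and [1 <= l]. A leaf [v] has [p = |av|] in [1, 2] and
   [q = |bv|] in [l/2, l], and two leaves [v], [w] satisfy
   [2 |vw| >= max(|av|, |bv|)]. Hence a sector of an annulus centred at a hub,
   with radii in [rmin, rmax] and opening angle [t], contains at most one leaf
   as soon as [8 cos t > 7] and [8 cos t rmin rmax > 3 rmax^2 + 4 rmin^2].

   For all values of [d] and [l], seven such sectors, with angles measured from
   the line [ab], cover the possible positions of leaves in a closed half-plane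
   bounded by [ab]. So there are at most 7 + 7 leaves. The plane is described
   by the coordinates [(p, q)], and [2 p d cos t = p^2 + d^2 - q^2] turns the
   covering into polynomial inequalities. The sectors are listed in a table for
   14 ranges of [(d, l)], and the covering of each box of values of [(d, p, q)]
   is certified by subdividing the box in integer arithmetic. *)

(** * Planar inequalities for two points in an annular sector *)

Section SectorGeometry.
Variable R : rcfType.
Local Open Scope ring_scope.

(** A concave function lies above its chord; the last term of the identity is the gap, multiplied by
    [x2 - x1]. *)
Lemma concave_quad_ge0 (a b n x1 x2 x : R) : 0 <= n -> x1 <= x <= x2 ->
  0 <= a + b * x1 - n * x1 ^+ 2 -> 0 <= a + b * x2 - n * x2 ^+ 2 ->
  0 <= a + b * x - n * x ^+ 2.
Proof.
move=> n0 /andP[x1x xx2] h1 h2.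
have [<-//|ne] := eqVneq x1 x.
have lt1 : 0 < x2 - x1 by rewrite subr_gt0 (lt_le_trans _ xx2) // lt_neqAle ne.
rewrite -(pmulr_rge0 _ lt1).
have -> : (x2 - x1) * (a + b * x - n * x ^+ 2) =
  (x2 - x) * (a + b * x1 - n * x1 ^+ 2) + (x - x1) * (a + b * x2 - n * x2 ^+ 2)
  + n * ((x - x1) * (x2 - x) * (x2 - x1)) by ring.
by rewrite !addr_ge0 // !mulr_ge0 ?(ltW lt1) // subr_ge0.
Qed.

(** With leading coefficient [- 4 * n], the function exceeds its chord by at most
    [n * (x2 - x1) ^+ 2], the excess at the midpoint. The factor 4 avoids fractions. *)
Lemma concave_quad_le0 (a b n x1 x2 x : R) : 0 <= n -> x1 <= x <= x2 ->
  a + b * x1 - 4 * n * x1 ^+ 2 + n * (x2 - x1) ^+ 2 <= 0 ->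
  a + b * x2 - 4 * n * x2 ^+ 2 + n * (x2 - x1) ^+ 2 <= 0 ->
  a + b * x - 4 * n * x ^+ 2 <= 0.
Proof.
move=> n0 /andP[x1x xx2] h1 h2.
have [eq|ne] := eqVneq x1 x.
  by move: h1; rewrite eq; apply: le_trans; rewrite lerDl mulr_ge0 ?sqr_ge0.
have lt1 : 0 < x2 - x1 by rewrite subr_gt0 (lt_le_trans _ xx2) // lt_neqAle ne.
rewrite -(pmulr_rle0 _ lt1).
have -> : (x2 - x1) * (a + b * x - 4 * n * x ^+ 2) =
  (x2 - x) * (a + b * x1 - 4 * n * x1 ^+ 2 + n * (x2 - x1) ^+ 2)
  + (x - x1) * (a + b * x2 - 4 * n * x2 ^+ 2 + n * (x2 - x1) ^+ 2)
  - (x2 - x1) * (n * (x2 + x1 - 2 * x) ^+ 2) by ring.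
have := mulr_ge0_le0 (_ : 0 <= x2 - x) h1.
have := mulr_ge0_le0 (_ : 0 <= x - x1) h2.
have : 0 <= (x2 - x1) * (n * (x2 + x1 - 2 * x) ^+ 2).
  by rewrite mulr_ge0 ?(ltW lt1) // mulr_ge0 // sqr_ge0.
by rewrite !subr_ge0 => ? /(_ x1x) ? /(_ xx2) ?; lra.
Qed.

(* Monotonicity of cos(t - t') in t, for angles of the first quadrant given by
   their cosines and sines. *)
Lemma dot_unit_le (c s c' s' c'' s'' : R) :
  0 <= c -> 0 <= s -> 0 <= s' -> 0 <= s'' -> c <= c' <= c'' ->
  c ^+ 2 + s ^+ 2 = 1 -> c' ^+ 2 + s' ^+ 2 = 1 -> c'' ^+ 2 + s'' ^+ 2 = 1 ->
  c * c'' + s * s'' <= c' * c'' + s' * s''.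
Proof.
move=> c0 s0 s'0 s''0 /andP[cc' c'c''] e e' e''.
have ss'' : s'' <= s' by rewrite -ler_sqr ?nnegrE //; nra.
have ss' : s' <= s by rewrite -ler_sqr ?nnegrE //; nra.
have [z|nz] := eqVneq (s + s') 0.
  have es : s = 0 by lra.
  have es' : s' = 0 by lra.
  by rewrite es es' !mul0r !addr0 ler_wpM2r //; lra.
have pos : 0 < s + s' by rewrite lt_neqAle eq_sym nz addr_ge0.
(* The factor [s + s'] turns the difference of the sines into one of the cosines; then
   [s'' <= s' <= s] and [c <= c' <= c''] give the sign. *)
rewrite -subr_ge0 -(pmulr_rge0 _ pos).
have -> : (s + s') * (c' * c'' + s' * s'' - (c * c'' + s * s'')) =
  (c' - c) * (c'' * (s + s') - s'' * (c + c')).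
  have h : (s' - s) * (s + s') = (c - c') * (c + c') by nra.
  transitivity ((s + s') * (c' - c) * c'' + (s' - s) * (s + s') * s'').
    by ring.
  by rewrite h; ring.
rewrite mulr_ge0 ?subr_ge0 //.
apply: (@le_trans _ _ (s'' * (2 * c''))).
  by rewrite ler_wpM2l //; lra.
by rewrite mulrCA mulrA mulrC ler_wpM2l //; lra.
Qed.


(** By the law of cosines, the angle between sides [x] and [d], opposite to [o], has cosine at most
    [c / n]. The right side minus the left one is concave in [x] and in [d] and increases with [o],
    so the corners at [o1] decide. *)
Lemma cross_ge (n c x1 x2 d1 d2 o1 x d o : R) : 0 <= n ->
  x1 <= x <= x2 -> d1 <= d <= d2 -> 0 <= o1 <= o ->
  (forall x' d', (x' = x1) \/ (x' = x2) -> (d' = d1) \/ (d' = d2) ->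
     n * (x' ^+ 2 + d' ^+ 2 - o1 ^+ 2) <= 2 * c * x' * d') ->
  n * (x ^+ 2 + d ^+ 2 - o ^+ 2) <= 2 * c * x * d.
Proof.
move=> n0 hx hd /andP[o10 o1o] corner.
have oo : o1 ^+ 2 <= o ^+ 2 by rewrite ler_sqr ?nnegrE // (le_trans o10).
have line d' : d' = d1 \/ d' = d2 ->
    0 <= (n * o1 ^+ 2 - n * d' ^+ 2) + (2 * c * d') * x - n * x ^+ 2.
  move=> hd'; apply: (concave_quad_ge0 n0 hx).
    by have := corner x1 d' (or_introl erefl) hd'; lra.
  by have := corner x2 d' (or_intror erefl) hd'; lra.
have := @concave_quad_ge0 (n * o1 ^+ 2 - n * x ^+ 2) (2 * c * x) n d1 d2 d
  n0 hd.
have l1 := line _ (or_introl erefl); have l2 := line _ (or_intror erefl).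
have no : n * o1 ^+ 2 <= n * o ^+ 2 by rewrite ler_wpM2l.
by move=> h; suff: 0 <= n * o1 ^+ 2 - n * x ^+ 2 + 2 * c * x * d - n * d ^+ 2;
  [lra | apply: h; lra].
Qed.

(** For a lower bound on the cosine, concavity goes the wrong way: the corner values are corrected
    by the largest excess over the chord, once for each of the two variables. *)
Lemma cross_le (n c x1 x2 d1 d2 o2 x d o : R) : 0 <= n ->
  x1 <= x <= x2 -> d1 <= d <= d2 -> 0 <= o <= o2 ->
  (forall x' d', (x' = x1) \/ (x' = x2) -> (d' = d1) \/ (d' = d2) ->
     8 * c * x' * d' + n * ((x2 - x1) ^+ 2 + (d2 - d1) ^+ 2) <=
     4 * n * (x' ^+ 2 + d' ^+ 2 - o2 ^+ 2)) ->
  2 * c * x * d <= n * (x ^+ 2 + d ^+ 2 - o ^+ 2).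
Proof.
move=> n0 hx hd /andP[o0 oo2] corner.
have oo : o ^+ 2 <= o2 ^+ 2 by rewrite ler_sqr ?nnegrE // (le_trans o0).
have line d' : d' = d1 \/ d' = d2 ->
    (4 * n * o2 ^+ 2 - 4 * n * d' ^+ 2 + n * (d2 - d1) ^+ 2) + (8 * c * d') * x
    - 4 * n * x ^+ 2 <= 0.
  move=> hd'; apply: (concave_quad_le0 n0 hx).
    by have := corner x1 d' (or_introl erefl) hd'; lra.
  by have := corner x2 d' (or_intror erefl) hd'; lra.
have := @concave_quad_le0 (4 * n * o2 ^+ 2 - 4 * n * x ^+ 2) (8 * c * x) n d1 d2
  d n0 hd.
have l1 := line _ (or_introl erefl); have l2 := line _ (or_intror erefl).
have no : n * o ^+ 2 <= n * o2 ^+ 2 by rewrite ler_wpM2l.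
by move=> h; suff: 4 * n * o2 ^+ 2 - 4 * n * x ^+ 2 + 8 * c * x * d
    - 4 * n * d ^+ 2 <= 0;
  [lra | apply: h; lra].
Qed.

(** For points at distances [r <= r'] from a hub, seen under an angle of cosine [k], the conclusion
    says that twice their distance is less than [r']. Only [r / r'] matters, and the hypotheses
    treat its extreme values 1 and [a / b]. *)
Lemma sq_ratio_lt (k a b r r' : R) : 0 < a -> 7 < 8 * k ->
  3 * b ^+ 2 + 4 * a ^+ 2 < 8 * k * a * b -> a <= r -> r <= r' -> r' <= b ->
  3 * r' ^+ 2 + 4 * r ^+ 2 < 8 * k * r * r'.
Proof.
move=> a0 k7 kab ar rr' r'b.
have r0 : 0 < r by lra.
have r'0 : 0 < r' by lra.
have b0 : 0 < b by lra.
have ab : a * r' <= r * b by rewrite ler_pM // ltW.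
have [eab|nab] := eqVneq a b.
  have er : r = a by lra.
  have er' : r' = a by lra.
  by move: kab; rewrite -eab er er' -!mulrA -!expr2.
have lab : 0 < b - a by rewrite subr_gt0 lt_neqAle nab; lra.
(* [t = r / r'] lies between [a / b] and [1], and [8 k t - 3 - 4 t^2] is
   concave in [t]. *)
rewrite -subr_gt0.
set g := _ - _.
have e : (b - a) * b ^+ 2 * g =
    ((r' - r) * (r' * b) * (8 * k * a * b - (3 * b ^+ 2 + 4 * a ^+ 2)) +
     (r * b - a * r') * (r' * b ^+ 2) * (8 * k - 7)) +
    4 * (r' - r) * (r * b - a * r') * (b - a) * b by rewrite /g; ring.
rewrite -(pmulr_rgt0 _ (mulr_gt0 lab (exprn_gt0 2 b0))) e.
apply: ltr_pwDl; last by rewrite !mulr_ge0 ?subr_ge0 ?(ltW b0) // -subr_ge0 ltW.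
(* Strictness comes from the second summand if [r = r'] and from the first otherwise. *)
have [e1|n1] := eqVneq r r'.
  have -> : r * b - a * r' = r' * (b - a) by rewrite e1; ring.
  rewrite e1 subrr !mul0r add0r mulr_gt0 ?subr_gt0 //.
  by rewrite mulr_gt0 ?mulr_gt0 ?exprn_gt0.
apply: ltr_pwDl; last first.
  by rewrite !mulr_ge0 ?subr_ge0 ?(ltW r'0) ?(ltW b0) ?(ltW k7).
by rewrite !mulr_gt0 ?subr_gt0 // lt_neqAle n1.
Qed.

(** The angle between two directions of a sector is largest for the two bounding rays. The sines
    [s1], [s2] may be underestimates, as rounded square roots will be. *)
Lemma dot_unit_ge (c1 s1 c2 s2 x y x' y' : R) :
  0 <= c1 -> 0 <= s1 -> 0 <= s2 -> c1 ^+ 2 + s1 ^+ 2 <= 1 ->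
  c2 ^+ 2 + s2 ^+ 2 <= 1 -> 0 <= y -> 0 <= y' ->
  x ^+ 2 + y ^+ 2 = 1 -> x' ^+ 2 + y' ^+ 2 = 1 ->
  c1 <= x <= c2 -> c1 <= x' <= c2 -> c1 * c2 + s1 * s2 <= x * x' + y * y'.
Proof.
wlog xx' : x y x' y' / x <= x' => [base|].
  have [xx'|/ltW x'x] := leP x x'; first exact: base.
  by move=> *; rewrite (mulrC x) (mulrC y); apply: base.
move=> c10 s10 s20 e1 e2 y0 y'0 e e' /andP[c1x xc2] /andP[c1x' x'c2].
have c20 : 0 <= c2 by lra.
pose S1 : R := Num.sqrt (1 - c1 ^+ 2); pose S2 : R := Num.sqrt (1 - c2 ^+ 2).
have S10 : 0 <= S1 by exact: sqrtr_ge0.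
have S20 : 0 <= S2 by exact: sqrtr_ge0.
have E1 : c1 ^+ 2 + S1 ^+ 2 = 1.
  by rewrite sqr_sqrtr; [ring|have := sqr_ge0 s1; lra].
have E2 : c2 ^+ 2 + S2 ^+ 2 = 1.
  by rewrite sqr_sqrtr; [ring|have := sqr_ge0 s2; lra].
have s1S1 : s1 <= S1 by rewrite -ler_sqr ?nnegrE //; lra.
have s2S2 : s2 <= S2 by rewrite -ler_sqr ?nnegrE //; lra.
have sq (u v : R) : 0 <= u -> u <= v -> u ^+ 2 <= v ^+ 2.
  by move=> u0 uv; rewrite ler_sqr ?nnegrE // (le_trans u0).
have S2y' : S2 <= y'.
  by rewrite -ler_sqr ?nnegrE //;
    have := sq x' c2 (le_trans c10 c1x') x'c2; lra.
have y'S1 : y' <= S1.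
  by rewrite -ler_sqr ?nnegrE //; have := sq c1 x' c10 c1x'; lra.
have h1 : c1 * x' + S1 * y' <= x * x' + y * y'.
  by apply: dot_unit_le => //; rewrite ?c1x.
(* The second direction is moved to its bounding ray with the roles of sine and cosine exchanged,
   which reverses the order of the angles. *)
have h2 : S2 * S1 + c2 * c1 <= y' * S1 + x' * c1.
  by apply: dot_unit_le => //; rewrite ?S2y' // 1?addrC //; lra.
have h3 : s1 * s2 <= S1 * S2 by rewrite ler_pM.
lra.
Qed.

Lemma sector_dist_lt (n a b c1 c2 s1 s2 x y r x' y' r' : R) :
  0 < n -> 0 <= c1 -> 0 <= s1 -> 0 <= s2 ->
  c1 ^+ 2 + s1 ^+ 2 <= n ^+ 2 -> c2 ^+ 2 + s2 ^+ 2 <= n ^+ 2 -> 0 < a ->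
  7 * n ^+ 2 < 8 * (c1 * c2 + s1 * s2) ->
  n ^+ 2 * (3 * b ^+ 2 + 4 * a ^+ 2) < 8 * (c1 * c2 + s1 * s2) * a * b ->
  0 <= y -> 0 <= y' -> r ^+ 2 = x ^+ 2 + y ^+ 2 ->
  r' ^+ 2 = x' ^+ 2 + y' ^+ 2 ->
  a <= r <= b -> a <= r' <= b ->
  c1 * r <= n * x <= c2 * r -> c1 * r' <= n * x' <= c2 * r' ->
  4 * ((x - x') ^+ 2 + (y - y') ^+ 2) < Num.max r r' ^+ 2.
Proof.
move=> n0 c10 s10 s20 e1 e2 a0 k7 kab y0 y'0 e e' hr hr' hx hx'.
have r0 : 0 < r by lra.
have r'0 : 0 < r' by lra.
(* A lower bound for the cosine of the angle between the two points. *)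
pose k := (c1 * c2 + s1 * s2) / n ^+ 2.
have n20 : 0 < n ^+ 2 by rewrite exprn_gt0.
have nk : c1 * c2 + s1 * s2 = k * n ^+ 2 by rewrite /k mulfVK // gt_eqF.
have dot : k * (r * r') <= x * x' + y * y'.
  have : c1 / n * (c2 / n) + s1 / n * (s2 / n) <=
         x / r * (x' / r') + y / r * (y' / r').
    have quot (u v w : R) : 0 < w -> u ^+ 2 + v ^+ 2 = w ^+ 2 ->
        (u / w) ^+ 2 + (v / w) ^+ 2 = 1.
      by move=> w0 h; rewrite !exprMn -mulrDl h -exprMn divff ?gt_eqF // expr1n.
    have quotle (u v : R) : u ^+ 2 + v ^+ 2 <= n ^+ 2 ->
        (u / n) ^+ 2 + (v / n) ^+ 2 <= 1.
      by move=> h; rewrite !exprMn -mulrDl exprVn ler_pdivrMr // mul1r.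
    have bnd (z w : R) : 0 < w -> c1 * w <= n * z <= c2 * w ->
        c1 / n <= z / w <= c2 / n.
      move=> w0 /andP[h1 h2]; apply/andP; split.
        by rewrite ler_pdivrMr // mulrAC ler_pdivlMr // (mulrC z).
      by rewrite ler_pdivrMr // mulrAC ler_pdivlMr // (mulrC z).
    apply: dot_unit_ge; try by rewrite divr_ge0 // ltW.
    - exact: quotle.
    - exact: quotle.
    - exact: quot.
    - exact: quot.
    - exact: bnd.
    - exact: bnd.
  have -> : c1 / n * (c2 / n) + s1 / n * (s2 / n) = k.
    by rewrite /k; field; rewrite gt_eqF.
  have -> : x / r * (x' / r') + y / r * (y' / r') =
      (x * x' + y * y') / (r * r').
    by field; rewrite !gt_eqF.
  by rewrite ler_pdivlMr ?mulr_gt0.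
have k7' : 7 < 8 * k by rewrite -(ltr_pM2r n20); lra.
have kab' : 3 * b ^+ 2 + 4 * a ^+ 2 < 8 * k * a * b.
  by rewrite -(ltr_pM2l n20); rewrite nk in kab; lra.
have [rr'|/ltW r'r] := leP r r'.
  by have := @sq_ratio_lt k a b r r' a0 k7' kab'; lra.
by have := @sq_ratio_lt k a b r' r a0 k7' kab'; lra.
Qed.

End SectorGeometry.

(* A sector at the hub [b] if [second_hub], at [a] otherwise. Lengths and
   cosines are multiplied by 10000. *)
Record cell := Cell {
  second_hub : bool; rmin : Z; rmax : Z; cmin : Z; cmax : Z }.

Record box := Box { dlo : Z; dhi : Z; plo : Z; phi : Z; qlo : Z; qhi : Z }.

(** * Integer certificates for the covering by sectors *)

Section Checker.
Local Open Scope Z_scope.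

Definition scale : Z := 10000.

(** The addition formula for the cosine of the opening angle, times [scale * scale]. Integer square
    roots round down, so for cosines between 0 and [scale] this is a lower bound. *)
Definition cos_opening (c : cell) : Z :=
  cmin c * cmax c + Z.sqrt (scale * scale - cmin c * cmin c) *
                    Z.sqrt (scale * scale - cmax c * cmax c).

Definition narrow (c : cell) : bool :=
  [&& 0 <=? cmin c, cmin c <=? scale, 0 <=? cmax c, cmax c <=? scale,
      0 <? rmin c,
      7 * (scale * scale) <? 8 * cos_opening c &
      scale * scale * (3 * (rmax c * rmax c) + 4 * (rmin c * rmin c)) <?
        8 * cos_opening c * rmin c * rmax c].

Definition at_corners (f : Z -> Z -> bool) (x1 x2 y1 y2 : Z) : bool :=
  [&& f x1 y1, f x1 y2, f x2 y1 & f x2 y2].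

(** A bound of at least [scale] holds trivially, as a cosine is at most 1. Otherwise the smallest
    opposite side [o1] is the worst case. *)
Definition cos_le_on (c x1 x2 o1 d1 d2 : Z) : bool :=
  (scale <=? c) ||
  (0 <=? o1) &&
  at_corners (fun x d => scale * (x * x + d * d - o1 * o1) <=? 2 * c * x * d)
    x1 x2 d1 d2.

(* The term with the squared widths bounds the defect of convexity. *)
Definition cos_ge_on (c x1 x2 o2 d1 d2 : Z) : bool :=
  at_corners (fun x d =>
    8 * c * x * d + scale * ((x2 - x1) * (x2 - x1) + (d2 - d1) * (d2 - d1))
    <=? 4 * scale * (x * x + d * d - o2 * o2)) x1 x2 d1 d2.

(* [Some t] means that the points of the box whose cosine is at least [t] are
   covered. *)
Fixpoint least_cos (h : bool) (x1 x2 o1 d1 d2 : Z) (t : option Z)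
    (cs : seq cell) : option Z :=
  if cs isn't c :: cs' then t else
  let linked := (if t is Some u then u <=? cmax c else false)
                || cos_le_on (cmax c) x1 x2 o1 d1 d2 in
  let t' := if (second_hub c == h) && (rmin c <=? x1) && (x2 <=? rmax c)
               && linked
            then Some (if t is Some u then Z.min u (cmin c) else cmin c)
            else t in
  least_cos h x1 x2 o1 d1 d2 t' cs'.

Definition chain_covers (h : bool) (cs : seq cell) (x1 x2 o1 o2 d1 d2 : Z)
    : bool :=
  if least_cos h x1 x2 o1 d1 d2 None cs is Some t
  then cos_ge_on t x1 x2 o2 d1 d2 else false.

(** Each test makes one inequality fail on the whole box: a triangle inequality, or one of the two
    imposed by the ply-disk of the leaf. *)
Definition no_admissible (B : box) : bool :=
  [|| phi B + qhi B <? dlo B, qhi B + dhi B <? plo B, phi B + dhi B <? qlo B,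
      2 * qhi B <? plo B | 2 * phi B <? qlo B].

Definition midpoint (x1 x2 : Z) : Z := (x1 + x2) / 2.

Definition between (x1 x2 x : Z) : bool := (x1 <? x) && (x <? x2).

(* A short interval is cut at the radius of a cell if possible: a box across
   the common radius of two cells lies in neither of them. *)
Definition cut (h : bool) (cs : seq cell) (x1 x2 : Z) : Z :=
  let radii := flatten [seq [:: rmin c; rmax c]
                       | c <- cs & second_hub c == h] in
  if x2 - x1 <=? 700
  then head (midpoint x1 x2) [seq x <- radii | between x1 x2 x]
  else midpoint x1 x2.

(** A longest side of the box is cut until a chain of cells at a single hub suffices; [fuel] bounds
    the depth. *)
Fixpoint covers (fuel : nat) (cs : seq cell) (B : box) : bool :=
  let: Box d1 d2 p1 p2 q1 q2 := B in
  if [|| no_admissible B, chain_covers false cs p1 p2 q1 q2 d1 d2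
       | chain_covers true cs q1 q2 p1 p2 d1 d2] then true
  else if fuel isn't fuel'.+1 then false
  else if (q2 - q1 <=? p2 - p1) && (d2 - d1 <=? p2 - p1) then
    let m := cut false cs p1 p2 in
    covers fuel' cs (Box d1 d2 p1 m q1 q2) &&
    covers fuel' cs (Box d1 d2 m p2 q1 q2)
  else if d2 - d1 <=? q2 - q1 then
    let m := cut true cs q1 q2 in
    covers fuel' cs (Box d1 d2 p1 p2 q1 m) &&
    covers fuel' cs (Box d1 d2 p1 p2 m q2)
  else
    let m := midpoint d1 d2 in
    covers fuel' cs (Box d1 m p1 p2 q1 q2) &&
    covers fuel' cs (Box m d2 p1 p2 q1 q2).

(** For [l] between [l1] and [l2], the bounds [l / 2 <= q <= l] put [q] between [l1 / 2] and [l2].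
    The final test ensures that the ranges reach the largest possible [l]. *)
Fixpoint covers_column (d1 d2 l1 : Z) (col : seq (Z * seq cell)) : bool :=
  if col isn't (l2, cs) :: col' then 2 * scale <=? l1 else
  [&& (size cs <= 7)%N, all narrow cs,
      covers 16 cs (Box d1 d2 scale (2 * scale) (l1 / 2) l2)
    & covers_column d1 d2 l2 col'].

Fixpoint covers_table (d1 : Z) (tab : seq (Z * seq (Z * seq cell))) : bool :=
  if tab isn't (d2, col) :: tab' then 4 * scale <=? d1 else
  covers_column d1 d2 scale col && covers_table d2 tab'.

Let cA := Cell false.
Let cB := Cell true.

(* An entry [(d2, col)] is for distances of the hubs up to [d2], an entry
   [(l2, cs)] of [col] for longest edges at the second hub up to [l2]; the
   lower bounds are those of the preceding entries. *)
Definition table : seq (Z * seq (Z * seq cell)) := [::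
  (10300, [:: (13700, [::
      cA 15416 20000 8756 10000; cA 11250 20000 7550 9239;
      cA 10000 11250 5626 8920; cA 11250 20000 5846 8115;
      cA 10000 11250 2970 7214; cA 11250 17084 2429 6428;
      cB 10800 13700 2558 6910]);
    (16700, [::
      cA 15000 20000 8756 10000; cA 12500 20000 6977 9292;
      cA 10000 12500 4743 8406; cA 12500 20000 4193 7531;
      cA 12500 18334 452 4930; cB 14237 16700 4706 8383;
      cB 10133 14238 3102 7197]);
    (18500, [::
      cA 16250 20000 8756 10000; cA 12500 20000 7029 9319;
      cA 12500 20000 4259 7579; cA 10000 12500 3474 7572;
      cA 12500 20000 1015 4984; cB 13425 18500 6384 9273;
      cB 11310 18500 3547 6935]);
    (19500, [::
      cA 17200 20000 8756 10000; cA 12400 20000 6589 9060;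
      cA 11800 20000 3784 6898; cA 10000 12000 2297 6713;
      cB 15480 19500 7503 9764; cB 12264 19500 4523 7795;
      cB 12264 19500 866 4892]);
    (20000, [::
      cA 17583 20000 8756 10000; cA 14250 20000 5824 8958;
      cA 10000 14250 3340 7333; cA 14250 20000 1507 5969;
      cB 17833 20000 8756 10000; cB 12750 20000 6262 8958;
      cB 11500 20000 3428 6422])]);
  (11000, [:: (12200, [::
      cA 15000 20000 8756 10000; cA 10833 20000 8149 9401;
      cA 10000 10834 6217 9228; cA 10833 19584 6931 8756;
      cA 10833 17084 3977 7440; cB 7117 12200 3229 6375]);
    (16200, [::
      cA 15416 20000 8756 10000; cA 12500 20000 7063 9336;
      cA 10000 12500 5361 8772; cA 12500 20000 4330 7630;
      cA 10000 12500 2278 6699; cB 11991 16200 4264 8083;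
      cB 11991 16200 333 5089]);
    (18600, [::
      cA 15416 20000 8351 9970; cA 12500 20000 6316 8929;
      cA 10000 12500 3852 7832; cA 12500 20000 3273 6842;
      cB 13560 18600 6249 9212; cB 10620 18600 4053 6868;
      cB 12300 18600 558 4889]);
    (20000, [::
      cA 16388 20000 8156 9937; cA 11944 20000 6106 8630;
      cA 11944 20000 3246 6555; cB 16433 20000 7852 9867;
      cB 13141 20000 5068 8321; cB 9300 13142 2532 6756;
      cB 13141 20000 1408 5586])]);
  (12000, [:: (20000, [::
      cA 13888 20000 7526 9713; cA 10000 13889 6158 9150;
      cA 13888 20000 4157 7877; cA 10000 13889 2779 6988;
      cB 14722 20000 7053 9586; cB 12222 20000 4161 7396;
      cB 12500 20000 736 4739])]);
  (14000, [:: (20000, [::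
      cA 10000 13750 7385 9703; cA 13750 20000 6928 9456;
      cA 10000 13750 4028 7894; cA 13750 20000 3507 7395;
      cB 12916 20000 6784 9273; cB 12083 20000 4073 7268;
      cB 14166 20000 91 4753])]);
  (18000, [:: (20000, [::
      cA 10000 13750 8860 10000; cA 10000 13750 6954 9535;
      cA 13750 20000 6996 9487; cA 10000 13750 3763 7715;
      cA 13750 20000 3550 7426; cB 13750 20000 5811 8885;
      cB 13750 20000 2121 6348])]);
  (22000, [:: (20000, [::
      cA 13750 19584 8857 10000; cA 10000 13750 8798 10000;
      cA 10000 13750 7037 9569; cA 13750 20000 6484 9244;
      cA 13750 20000 2857 6917; cB 12500 20000 8238 9834;
      cB 12500 20000 5975 8726])]);
  (40000, [:: (20000, [::
      cA 11666 20000 9351 10000; cA 10000 12500 8778 10000;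
      cA 11666 20000 8800 9913; cA 12500 20000 7009 9309;
      cB 12500 20000 9131 10000; cB 12500 20000 7754 9656;
      cB 14166 20000 4565 8194])])].

Lemma table_covers : covers_table scale table.
Proof. by vm_compute. Qed.

End Checker.

(** * From integer certificates to real inequalities *)

Section Soundness.
Variable R : rcfType.
Local Open Scope ring_scope.

Definition Z2R (z : Z) : R := (int_of_Z z)%:~R.

Lemma Z2RD x y : Z2R (x + y) = Z2R x + Z2R y.
Proof. by rewrite -rmorphD -rmorphD. Qed.

Lemma Z2RM x y : Z2R (x * y) = Z2R x * Z2R y.
Proof. by rewrite -rmorphM -rmorphM. Qed.

Lemma Z2RB x y : Z2R (x - y) = Z2R x - Z2R y.
Proof. by rewrite -rmorphB -rmorphB. Qed.

Lemma Z2R_nat n : Z2R (Z.of_nat n) = n%:R.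
Proof.
by rewrite /Z2R (_ : int_of_Z _ = Posz n) ?pmulrn //; lia.
Qed.

Lemma Z2R_le x y : Z.leb x y -> Z2R x <= Z2R y.
Proof. by move=> xy; rewrite ler_int; lia. Qed.

Lemma Z2R_lt x y : Z.ltb x y -> Z2R x < Z2R y.
Proof. by move=> xy; rewrite ltr_int; lia. Qed.

Lemma Z2R_0 : Z2R 0 = 0. Proof. exact: (Z2R_nat 0). Qed.
Lemma Z2R_2 : Z2R 2 = 2. Proof. exact: (Z2R_nat 2). Qed.
Lemma Z2R_3 : Z2R 3 = 3. Proof. exact: (Z2R_nat 3). Qed.
Lemma Z2R_4 : Z2R 4 = 4. Proof. exact: (Z2R_nat 4). Qed.
Lemma Z2R_7 : Z2R 7 = 7. Proof. exact: (Z2R_nat 7). Qed.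
Lemma Z2R_8 : Z2R 8 = 8. Proof. exact: (Z2R_nat 8). Qed.
Definition Z2RE := (Z2RD, Z2RB, Z2RM, Z2R_0, Z2R_2, Z2R_3, Z2R_4, Z2R_7, Z2R_8).


Local Notation n := (Z2R scale).

Lemma scale_gt0 : 0 < n. Proof. by rewrite -Z2R_0; exact: Z2R_lt. Qed.

(* [2 x d cos t = x^2 + d^2 - o^2] for the angle [t] opposite to [o]. *)
Definition in_sector (c : cell) (d x o : R) : bool :=
  [&& Z2R (rmin c) <= x <= Z2R (rmax c),
      2 * Z2R (cmin c) * x * d <= n * (x ^+ 2 + d ^+ 2 - o ^+ 2) &
      n * (x ^+ 2 + d ^+ 2 - o ^+ 2) <= 2 * Z2R (cmax c) * x * d].

Definition inside (d p q : R) (c : cell) : bool :=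
  if second_hub c then in_sector c d q p else in_sector c d p q.

(** The triangle inequalities for the hubs and a leaf, followed by the two conditions from the
    ply-disk of the leaf. *)
Definition admissible (d p q : R) : bool :=
  [&& 0 <= d, 0 <= p, 0 <= q, d <= p + q, p <= q + d, q <= p + d,
      p <= 2 * q & q <= 2 * p].

Definition in_box (B : box) (d p q : R) : bool :=
  [&& Z2R (dlo B) <= d <= Z2R (dhi B), Z2R (plo B) <= p <= Z2R (phi B)
    & Z2R (qlo B) <= q <= Z2R (qhi B)].

Lemma at_cornersP (f : Z -> Z -> bool) x1 x2 y1 y2 (P : R -> R -> Prop) :
  (forall x y, f x y -> P (Z2R x) (Z2R y)) -> at_corners f x1 x2 y1 y2 ->
  forall x y : R, x = Z2R x1 \/ x = Z2R x2 -> y = Z2R y1 \/ y = Z2R y2 -> P x y.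
Proof.
by move=> fP /and4P[? ? ? ?] x y [] -> [] ->; apply: fP.
Qed.

Lemma cos_le_onP c x1 x2 o1 d1 d2 (x d o : R) :
  cos_le_on c x1 x2 o1 d1 d2 -> 0 <= x -> 0 <= d -> 0 <= o ->
  x <= o + d -> d <= x + o ->
  Z2R x1 <= x <= Z2R x2 -> Z2R d1 <= d <= Z2R d2 -> Z2R o1 <= o ->
  n * (x ^+ 2 + d ^+ 2 - o ^+ 2) <= 2 * Z2R c * x * d.
Proof.
move=> /orP[/Z2R_le nc|/andP[o10 hc]] x0 d0 o0 xod dxo hx hd ho.
  have nxd : n * (x * d) <= Z2R c * (x * d).
    by rewrite ler_wpM2r ?mulr_ge0.
  (* The cosine is at most 1: this amounts to [|x - d| <= o], factored below as a difference of
     squares. *)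
  suff : n * (x ^+ 2 + d ^+ 2 - o ^+ 2) <= n * (2 * (x * d)) by lra.
  rewrite ler_pM2l ?scale_gt0 //.
  suff : 0 <= (o - (x - d)) * (o + (x - d)) by lra.
  by rewrite mulr_ge0 //; lra.
apply: (cross_ge (ltW scale_gt0) hx hd (o1 := Z2R o1)).
  by rewrite ho -Z2R_0 Z2R_le.
by apply: at_cornersP hc => x' y' /Z2R_le; rewrite !Z2RE.
Qed.

Lemma cos_ge_onP c x1 x2 o2 d1 d2 (x d o : R) :
  cos_ge_on c x1 x2 o2 d1 d2 ->
  Z2R x1 <= x <= Z2R x2 -> Z2R d1 <= d <= Z2R d2 -> 0 <= o <= Z2R o2 ->
  2 * Z2R c * x * d <= n * (x ^+ 2 + d ^+ 2 - o ^+ 2).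
Proof.
move=> hc hx hd ho; apply: (cross_le (ltW scale_gt0) hx hd ho).
by apply: at_cornersP hc => x' y' /Z2R_le; rewrite !Z2RE.
Qed.

Lemma chain_coversP h cs x1 x2 o1 o2 d1 d2 (x d o : R) :
  chain_covers h cs x1 x2 o1 o2 d1 d2 -> 0 <= x -> 0 <= d -> 0 <= o ->
  x <= o + d -> d <= x + o ->
  Z2R x1 <= x <= Z2R x2 -> Z2R d1 <= d <= Z2R d2 -> Z2R o1 <= o <= Z2R o2 ->
  has (fun c => (second_hub c == h) && in_sector c d x o) cs.
Proof.
rewrite /chain_covers.
case E: least_cos => [t|//] tge x0 d0 o0 xod dxo hx hd /andP[o1o oo2].
have {tge} tge := cos_ge_onP tge hx hd (introT andP (conj o0 oo2)).
have xd0 : 0 <= x * d by rewrite mulr_ge0.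
(* Invariant of the scan: a point not caught by the remaining cells already has cosine at least the
   current threshold [t0]. *)
have aux (t0 : option Z) : least_cos h x1 x2 o1 d1 d2 t0 cs = Some t ->
    has (fun c => (second_hub c == h) && in_sector c d x o) cs \/
    exists2 u, t0 = Some u &
      2 * Z2R u * x * d <= n * (x ^+ 2 + d ^+ 2 - o ^+ 2).
  elim: cs t0 {E} => [|c cs IH] t0 /=; first by move=> ->; right; exists t.
  set t1 := if _ then _ else _.
  case/IH => [->|[u]]; first by left; rewrite orbT.
  rewrite {}/t1; case: ifP => [/andP[/andP[/andP[-> r1] r2] lnk] [uE]|_ -> hu];
    last first.
    by right; exists u.
  have rx : Z2R (rmin c) <= x <= Z2R (rmax c).
    by move/Z2R_le: r1; move/Z2R_le: r2; lra.
  have mono (u1 u2 : Z) : Z.leb u1 u2 ->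
      2 * Z2R u1 * x * d <= 2 * Z2R u2 * x * d.
    by move/Z2R_le => h12; have := ler_wpM2r xd0 h12; lra.
  (* Below [cmin c], the new threshold can only be the old one; above [cmax c], the link to the
     chain places the point in the part covered before. *)
  move=> hu; have [hmax|hmax] :=
    lerP (n * (x ^+ 2 + d ^+ 2 - o ^+ 2)) (2 * Z2R (cmax c) * x * d).
    have [hmin|hmin] :=
      lerP (2 * Z2R (cmin c) * x * d) (n * (x ^+ 2 + d ^+ 2 - o ^+ 2)).
      by left; rewrite /in_sector rx hmax hmin.
    right; case: t0 lnk uE => [v|] lnk uE; last by move: hu; rewrite -uE; lra.
    exists v => //; have [vc|cv] := Z.leb_spec v (cmin c).
      by rewrite Z.min_l // in uE; rewrite uE.
    by move: hu; rewrite -uE (Z.min_r _ _ (Z.lt_le_incl _ _ cv)); lra.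
  have nle : cos_le_on (cmax c) x1 x2 o1 d1 d2 = false.
    by apply/negP => /cos_le_onP h'; move: hmax; rewrite ltNge h'.
  move: lnk; rewrite nle orbF; case: t0 uE => [v|//] uE vc.
  right; exists v => //; apply: le_trans (ltW hmax).
  exact: mono.
by case: (aux None E) => // -[].
Qed.

Lemma covers_leafP cs B (d p q : R) :
  [|| no_admissible B,
      chain_covers false cs (plo B) (phi B) (qlo B) (qhi B) (dlo B) (dhi B)
    | chain_covers true cs (qlo B) (qhi B) (plo B) (phi B) (dlo B) (dhi B)] ->
  in_box B d p q -> admissible d p q -> has (inside d p q) cs.
Proof.
move=> + /and3P[hd hp hq] /and5P[d0 p0 q0 dpq /and4P[pqd qpd p2q q2p]].
case/or3P => [|/chain_coversP h|/chain_coversP h].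
- by case/or4P => [|||/orP[]] /Z2R_lt; rewrite ?Z2RE; lra.
- have : has (fun c => (second_hub c == false) && in_sector c d p q) cs.
    exact: h.
  by apply: sub_has => c /andP[/eqP e ?]; rewrite /inside e.
- have : has (fun c => (second_hub c == true) && in_sector c d q p) cs.
    by apply: h => //; rewrite addrC.
  by apply: sub_has => c /andP[/eqP e ?]; rewrite /inside e.
Qed.

Lemma coversP fuel cs B (d p q : R) : covers fuel cs B -> in_box B d p q ->
  admissible d p q -> has (inside d p q) cs.
Proof.
move=> + + tri.
(* Every cut point is sound, even one outside the interval, so nothing has to be proved about [cut]
   and [midpoint]. *)
have split_at (x1 m x2 x : R) : x1 <= x <= x2 -> x1 <= x <= m \/ m <= x <= x2.
  by case/andP=> h1 h2; case: (lerP x m) => h; [left|right];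
    rewrite ?h1 ?h2 ?h ?ltW.
elim: fuel B => [|fuel IH] [d1 d2 p1 p2 q1 q2] /=; case: ifP => //.
- by move=> hleaf _ hB; apply: covers_leafP hleaf hB tri.
- by move=> hleaf _ hB; apply: covers_leafP hleaf hB tri.
move=> _; case: ifP => _; [|case: ifP => _];
  move=> /andP[/IH h1 /IH h2] /and3P[/= hd hp hq].
- by have [hm|hm] := split_at _ (Z2R (cut false cs p1 p2)) _ _ hp;
    [apply: h1|apply: h2]; apply/and3P.
- by have [hm|hm] := split_at _ (Z2R (cut true cs q1 q2)) _ _ hq;
    [apply: h1|apply: h2]; apply/and3P.
- by have [hm|hm] := split_at _ (Z2R (midpoint d1 d2)) _ _ hd;
    [apply: h1|apply: h2]; apply/and3P.
Qed.

#[local] Arguments covers : simpl never.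
#[local] Arguments Z.mul : simpl never.

Definition good_cover (d l : R) (cs : seq cell) : Prop :=
  [/\ (size cs <= 7)%N, all narrow cs & forall p q,
    n <= p <= 2 * n -> l <= 2 * q -> q <= l ->
    admissible d p q -> has (inside d p q) cs].

(** The strict inequality required for an empty column contradicts its final test; in the recursion
    it comes from [l] exceeding the preceding range. *)
Lemma covers_columnP d1 d2 l1 col (d l : R) : covers_column d1 d2 l1 col ->
  Z2R d1 <= d <= Z2R d2 -> Z2R l1 <= l <= 2 * n -> (nilp col -> Z2R l1 < l) ->
  exists cs, good_cover d l cs.
Proof.
move=> + hd; elim: col l1 => [|[l2 cs] col IH] l1 /=.
  by move=> /Z2R_le; rewrite !Z2RE => h hl /(_ isT); lra.
case/and4P=> sz nar cov /IH rest hl _; have [ll2|l2l] := lerP l (Z2R l2).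
  exists cs; split=> // p q hp lq ql; apply: (coversP cov) => {cov rest}.
  (* Integer division rounds down, so [l1 / 2] remains a lower bound for [q]. *)
  have half : Z2R (2 * (l1 / 2)) <= Z2R l1.
    by apply/Z2R_le/Z.leb_le; exact: Z.mul_div_le.
  by rewrite !Z2RE in half; apply/and3P; rewrite /= !Z2RE; split; lra.
by apply: rest => // {cov}; lra.
Qed.

Lemma covers_tableP d1 tab (d l : R) : covers_table d1 tab ->
  Z2R d1 <= d <= 4 * n -> n <= l <= 2 * n -> (nilp tab -> Z2R d1 < d) ->
  exists cs, good_cover d l cs.
Proof.
move=> + + hl; elim: tab d1 => [|[d2 col] tab IH] d1 /=.
  by move=> /Z2R_le; rewrite !Z2RE => h hd /(_ isT); lra.
case/andP=> hcol /IH rest hd _; have [dd2|d2d] := lerP d (Z2R d2).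
  by apply: (covers_columnP hcol) => //; [lra|case: col hcol].
by apply: rest => //; lra.
Qed.

Lemma table_good_cover (d l : R) : n <= d <= 4 * n -> n <= l <= 2 * n ->
  exists cs, good_cover d l cs.
Proof. by move=> hd hl; apply: (covers_tableP table_covers). Qed.

Lemma Z2R_sqrt z : Z.leb 0 z -> Z.leb z scale ->
  Z2R z ^+ 2 + Z2R (Z.sqrt (scale * scale - z * z)) ^+ 2 <= n ^+ 2.
Proof.
move=> /Z.leb_le z0 /Z.leb_le z1.
have h : Z.le 0 (scale * scale - z * z) by nia.
have [h1 _] := Z.sqrt_spec _ h.
rewrite !expr2 -!Z2RM -Z2RD; apply: Z2R_le; apply/Z.leb_le; lia.
Qed.

(* The points lie in the closed upper half-plane, with the hubs at [0] and at
   [(d, 0)]. *)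
Lemma narrow_dist_lt c (d x y p q x' y' p' q' : R) : narrow c -> 0 < d ->
  0 <= y -> 0 <= y' -> 0 <= p -> 0 <= q -> 0 <= p' -> 0 <= q' ->
  p ^+ 2 = x ^+ 2 + y ^+ 2 -> q ^+ 2 = (x - d) ^+ 2 + y ^+ 2 ->
  p' ^+ 2 = x' ^+ 2 + y' ^+ 2 -> q' ^+ 2 = (x' - d) ^+ 2 + y' ^+ 2 ->
  inside d p q c -> inside d p' q' c ->
  exists2 r, r \in [:: p; q; p'; q'] &
    4 * ((x - x') ^+ 2 + (y - y') ^+ 2) < r ^+ 2.
Proof.
move=> nar d0 y0 y'0 p0 q0 p'0 q'0 ep eq ep' eq' ins ins'.
case/andP: nar => cmin0 /and5P[cmin1 cmax0 cmax1 rmin0 /andP[k7 kab]].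
have S1 := Z2R_sqrt cmin0 cmin1; have S2 := Z2R_sqrt cmax0 cmax1.
have sqrt_ge0 z : 0 <= Z2R (Z.sqrt z).
  by rewrite -Z2R_0; apply/Z2R_le/Z.leb_le; exact: Z.sqrt_nonneg.
move/Z2R_le: cmin0; move/Z2R_lt: rmin0; rewrite !Z2RE => a0 c10.
pose K := Z2R (cmin c) * Z2R (cmax c) +
  Z2R (Z.sqrt (scale * scale - cmin c * cmin c)) *
  Z2R (Z.sqrt (scale * scale - cmax c * cmax c)).
have KE : Z2R (cos_opening c) = K.
  by rewrite Z2RD !(Z2RM _ (cmax c), Z2RM (Z.sqrt _)).
have {}k7 : 7 * n ^+ 2 < 8 * K.
  by move/Z2R_lt: k7;
    rewrite !(Z2RM _ (cos_opening c), KE, Z2RM _ (scale * scale), Z2RM scale,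
              Z2R_7, Z2R_8).
have {}kab : n ^+ 2 * (3 * Z2R (rmax c) ^+ 2 + 4 * Z2R (rmin c) ^+ 2) <
    8 * K * Z2R (rmin c) * Z2R (rmax c).
  by move/Z2R_lt: kab; rewrite !Z2RM KE !Z2RE.
have d20 : 0 < 2 * d by rewrite mulr_gt0.
(* Common to both hubs: [u] is the abscissa measured from the hub towards the other one, [x] or
   [d - x], and the law of cosines expression equals [2 * u * d]. *)
have key u u' r r' : r ^+ 2 = u ^+ 2 + y ^+ 2 -> r' ^+ 2 = u' ^+ 2 + y' ^+ 2 ->
    Z2R (rmin c) <= r <= Z2R (rmax c) -> Z2R (rmin c) <= r' <= Z2R (rmax c) ->
    2 * Z2R (cmin c) * r * d <= n * (2 * u * d) <= 2 * Z2R (cmax c) * r * d ->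
    2 * Z2R (cmin c) * r' * d <= n * (2 * u' * d) <= 2 * Z2R (cmax c) * r' * d ->
    4 * ((u - u') ^+ 2 + (y - y') ^+ 2) < Num.max r r' ^+ 2.
  move=> er er' hr hr' hu hu'.
  apply: (sector_dist_lt scale_gt0 c10 (sqrt_ge0 _) (sqrt_ge0 _) S1 S2 a0 k7 kab)
    => //.
    by apply/andP; split; rewrite -(ler_pM2r d20); lra.
  by apply/andP; split; rewrite -(ler_pM2r d20); lra.
have maxr (r r' : R) : Num.max r r' \in [:: r; r'].
  by rewrite !inE; case: (leP r r') => _; rewrite eqxx ?orbT.
move: ins ins'; rewrite /inside.
case: ifP => _ /and3P[hr h1 h2] /and3P[hr' h1' h2'].
  exists (Num.max q q').
    by have := maxr q q'; rewrite !inE => /orP[] ->; rewrite ?orbT.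
  have := key (d - x) (d - x') q q'.
  have -> : d - x - (d - x') = - (x - x') by ring.
  rewrite sqrrN; apply => //.
  - by rewrite eq; ring.
  - by rewrite eq'; ring.
  - by rewrite ep eq in h1 h2; lra.
  - by rewrite ep' eq' in h1' h2'; lra.
exists (Num.max p p').
  by have := maxr p p'; rewrite !inE => /orP[] ->; rewrite ?orbT.
by apply: key => //; [rewrite ep eq in h1 h2|rewrite ep' eq' in h1' h2']; lra.
Qed.

End Soundness.

(** * Counting leaves in half-planes and in drawings *)

Section Drawings.
Variable R : realType.
Local Open Scope ring_scope.
Local Notation n := (@Z2R R scale).

(** All three follow from [|x| <= p] and [|x - d| <= q], the last two after squaring. *)
Lemma triangle_coords (d x y p q : R) : 0 <= d -> 0 <= p -> 0 <= q ->
  p ^+ 2 = x ^+ 2 + y ^+ 2 -> q ^+ 2 = (x - d) ^+ 2 + y ^+ 2 ->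
  [/\ d <= p + q, p <= q + d & q <= p + d].
Proof.
move=> d0 p0 q0 ep eq.
have le_norm (u w r : R) : 0 <= r -> r ^+ 2 = u ^+ 2 + w ^+ 2 -> `|u| <= r.
  move=> r0 e; rewrite -ler_sqr ?nnegrE // real_normK ?num_real //.
  by rewrite e lerDl sqr_ge0.
have /ler_normlP[xp1 xp2] := le_norm _ _ _ p0 ep.
have /ler_normlP[xq1 xq2] := le_norm _ _ _ q0 eq.
split; first by lra.
- have h : (x - d) * d <= q * d by rewrite ler_wpM2r.
  by rewrite -ler_sqr ?nnegrE ?addr_ge0 //; lra.
- have h : - x * d <= p * d by rewrite ler_wpM2r.
  by rewrite -ler_sqr ?nnegrE ?addr_ge0 //; lra.
Qed.

(** Pigeonhole: each leaf is sent to the first cell containing it, and two leaves in one narrow cell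
    would violate the separation. *)
Lemma half_plane_card (I : finType) (S : {pred I}) (d l : R)
    (x y p q : I -> R) :
  n <= d -> n <= l <= 2 * n ->
  (forall i, 0 <= p i /\ 0 <= q i) ->
  (forall i, p i ^+ 2 = x i ^+ 2 + y i ^+ 2) ->
  (forall i, q i ^+ 2 = (x i - d) ^+ 2 + y i ^+ 2) ->
  (forall i, n <= p i <= 2 * n /\ q i <= l <= 2 * q i) ->
  (forall i, p i <= 2 * q i /\ q i <= 2 * p i) ->
  (forall i j, i != j ->
     p i ^+ 2 <= 4 * ((x i - x j) ^+ 2 + (y i - y j) ^+ 2) /\
     q i ^+ 2 <= 4 * ((x i - x j) ^+ 2 + (y i - y j) ^+ 2)) ->
  {in S, forall i, 0 <= y i} -> (#|S| <= 7)%N.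
Proof.
move=> nd nl pq0 ep eq hpq r2 sep Sy.
have n0 : 0 < n := @scale_gt0 R.
have tri i := triangle_coords (le_trans (ltW n0) nd) (pq0 i).1 (pq0 i).2
  (ep i) (eq i).
(* The bound [d <= p + q <= 4 * n] is read off from a leaf. *)
have [/existsP[i0 _]|S0] := boolP [exists i, i \in S]; last first.
  by rewrite eq_card0 // => i; apply: contraNF S0 => Si;
    apply/existsP; exists i.
have d4 : n <= d <= 4 * n.
  by have [] := tri i0; have := hpq i0; lra.
have [cs [size7 narrow_cs cover]] := table_good_cover d4 nl.
have has_cell i : has (inside d (p i) (q i)) cs.
  have [? ?] := hpq i; have [? ? ?] := tri i; have [? ?] := pq0 i.
  have [? ?] := r2 i.
  by apply: cover; rewrite /admissible; lra.
pose f i : 'I_7 := inord (find (inside d (p i) (q i)) cs).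
have fE i : f i = find (inside d (p i) (q i)) cs :> nat.
  by rewrite inordK // (leq_trans _ size7) // -has_find.
rewrite -[X in (_ <= X)%N]card_ord; apply: (leq_card_in f) => i j Si Sj fij.
apply/eqP; apply: contraT => ij.
pose c := nth (Cell false Z0 Z0 Z0 Z0) cs (f i).
have ci : inside d (p i) (q i) c by rewrite /c fE; apply: nth_find.
have cj : inside d (p j) (q j) c by rewrite /c fij fE; apply: nth_find.
have nar : narrow c.
  by apply: (elimT (all_nthP _) narrow_cs); rewrite fE -has_find.
have [|r] := narrow_dist_lt nar _ (Sy i Si) (Sy j Sj) (pq0 i).1 (pq0 i).2
  (pq0 j).1 (pq0 j).2 (ep i) (eq i) (ep j) (eq j) ci cj.
  exact: lt_le_trans nd.
(* The radius [r] may belong to either leaf, so the separation is used in both orders. *)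
have [? ?] := sep i j ij; rewrite eq_sym in ij; have := sep j i ij.
rewrite -[x j - x i]opprB -[y j - y i]opprB !sqrrN => -[? ?].
by rewrite !inE => /or4P[] /eqP -> h; exfalso; lra.
Qed.

Lemma edist_ge0 (u w : R * R) : 0 <= edist u w.
Proof. exact: sqrtr_ge0. Qed.

Lemma edistC (u w : R * R) : edist u w = edist w u.
Proof. by rewrite /edist -opprB sqrrN -[u.2 - w.2]opprB sqrrN. Qed.

Lemma sqr_edist (u w : R * R) :
  edist u w ^+ 2 = (u.1 - w.1) ^+ 2 + (u.2 - w.2) ^+ 2.
Proof. by rewrite sqr_sqrtr // addr_ge0 ?sqr_ge0. Qed.

Lemma edist_gt0 (u w : R * R) : (0 < edist u w) = (u != w).
Proof.
case: u w => [u1 u2] [w1 w2]; rewrite sqrtr_gt0 lt0r addr_ge0 ?sqr_ge0 // andbT.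
by rewrite paddr_eq0 ?sqr_ge0 // !sqrf_eq0 !subr_eq0 -xpair_eqE.
Qed.

(** A similarity sends [a] to the origin, [b] to the positive first axis and [la] to [2 * n]; the
    two closed half-planes then hold at most seven leaves each. *)
Lemma two_hubs_card (I : finType) (a b : R * R) (v : I -> R * R) (la lb : R) :
  0 < la -> lb <= la <= 2 * lb -> la <= 2 * edist a b ->
  (forall i, edist a (v i) <= la <= 2 * edist a (v i)) ->
  (forall i, edist b (v i) <= lb <= 2 * edist b (v i)) ->
  (forall i, edist a (v i) <= 2 * edist b (v i) /\
             edist b (v i) <= 2 * edist a (v i)) ->
  (forall i j, i != j -> edist a (v i) <= 2 * edist (v i) (v j) /\
                         edist b (v i) <= 2 * edist (v i) (v j)) ->
  (#|I| <= 14)%N.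
Proof.
move=> la0 hlb hD hA hB r2 sep.
have n0 : 0 < n := @scale_gt0 R.
set D := edist a b in hD; have D0 : 0 < D by lra.
have D2 := sqr_edist a b; rewrite -/D in D2.
have Dn0 : D != 0 by rewrite gt_eqF.
pose k := 2 * n / la.
have k0 : 0 < k by rewrite divr_gt0 ?mulr_gt0.
have kla : k * la = 2 * n by rewrite /k mulfVK ?gt_eqF.
pose e1 := b.1 - a.1; pose e2 := b.2 - a.2.
have D2e : D ^+ 2 = e1 ^+ 2 + e2 ^+ 2 by rewrite D2 /e1 /e2; ring.
(* Lagrange's identity: the new coordinates multiply lengths by [k]. *)
have frame (u1 u2 : R) : (k * (u1 * e1 + u2 * e2) / D) ^+ 2 +
    (k * (u1 * e2 - u2 * e1) / D) ^+ 2 = k ^+ 2 * (u1 ^+ 2 + u2 ^+ 2).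
  transitivity (k ^+ 2 * (u1 ^+ 2 + u2 ^+ 2) * (e1 ^+ 2 + e2 ^+ 2) / D ^+ 2).
    by field.
  by rewrite -D2e mulfK // expf_neq0.
pose x i := k * (((v i).1 - a.1) * e1 + ((v i).2 - a.2) * e2) / D.
pose y i := k * (((v i).1 - a.1) * e2 - ((v i).2 - a.2) * e1) / D.
pose p i := k * edist a (v i); pose q i := k * edist b (v i).
have klow (u w : R) : u <= w -> k * u <= k * w by rewrite ler_pM2l.
(* The sign [s] reflects the lower half-plane onto the upper one. *)
have half (s : R) (S : {pred I}) : s ^+ 2 = 1 ->
    {in S, forall i, 0 <= s * y i} -> (#|S| <= 7)%N.
  move=> s2;
    apply: (@half_plane_card I S (k * D) (k * lb) x (fun i => s * y i) p q).
  - by have := klow _ _ hD; lra.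
  - by case/andP: hlb => /klow h1 /klow h2; lra.
  - by move=> i; split; rewrite mulr_ge0 ?edist_ge0 ?(ltW k0).
  - move=> i; rewrite [(s * _) ^+ 2]exprMn s2 mul1r /p exprMn sqr_edist.
    by rewrite /x /y frame; ring.
  - move=> i; rewrite [(s * _) ^+ 2]exprMn s2 mul1r /q exprMn sqr_edist.
    have -> : x i - k * D =
        k * (((v i).1 - b.1) * e1 + ((v i).2 - b.2) * e2) / D.
      apply: (mulIf Dn0).
      rewrite mulrBl -[k * D * D]mulrA -expr2 D2e /x !mulfVK //.
      by rewrite /e1 /e2; ring.
    have -> : y i = k * (((v i).1 - b.1) * e2 - ((v i).2 - b.2) * e1) / D.
      by rewrite /y /e1 /e2; congr (_ / _); ring.
    by rewrite frame; ring.
  - move=> i; case/andP: (hA i) => /klow h1 /klow h2.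
    case/andP: (hB i) => /klow h3 /klow h4.
    by rewrite /p /q; split; lra.
  - by move=> i; case: (r2 i) => /klow h1 /klow h2; rewrite /p /q; split; lra.
  - move=> i j ij; rewrite -mulrBr [(s * _) ^+ 2]exprMn s2 mul1r.
    have -> : x i - x j =
        k * (((v i).1 - (v j).1) * e1 + ((v i).2 - (v j).2) * e2) / D.
      by rewrite -mulrBl -mulrBr; congr (_ * _ / _); ring.
    have -> : y i - y j =
        k * (((v i).1 - (v j).1) * e2 - ((v i).2 - (v j).2) * e1) / D.
      by rewrite -mulrBl -mulrBr; congr (_ * _ / _); ring.
    rewrite frame -sqr_edist.
    have -> : 4 * (k ^+ 2 * edist (v i) (v j) ^+ 2) =
        (k * (2 * edist (v i) (v j))) ^+ 2 by ring.
    case: (sep i j ij) => /klow h1 /klow h2.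
    have pos (u : R) : 0 <= u -> k * u \is Num.nneg.
      by move=> u0; rewrite nnegrE mulr_ge0 ?(ltW k0).
    by split; rewrite ler_sqr ?pos ?mulr_ge0 ?edist_ge0.
pose A := [pred i | 0 <= y i]; pose B := [pred i | y i <= 0].
have up : (#|A| <= 7)%N.
  by apply: (half 1) => [|i]; rewrite ?expr1n // mul1r.
have down : (#|B| <= 7)%N.
  by apply: (half (-1)) => [|i]; rewrite ?sqrrN ?expr1n // mulN1r oppr_ge0.
have -> : #|I| = #|[predU A & B]|.
  by apply: eq_card => i; rewrite !inE le_total.
by rewrite (leq_trans _ (leq_add up down)) // -cardUI leq_addr.
Qed.


Lemma longest_edge_ge (G : sgraph) (d : drawing R G) (u v : G) :
  adj u v -> edist (d u) (d v) <= longest_edge d u.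
Proof. by move=> uv; apply: (bigmax_sup v). Qed.

Lemma empty_ply_longest_edge (G : sgraph) (d : drawing R G) (u v : G) :
  empty_ply d -> u != v -> longest_edge d u <= 2 * edist (d u) (d v).
Proof.
rewrite eq_sym => ply uv; have /negP := ply u v uv.
by rewrite -leNgt ler_pdivrMr // mulrC.
Qed.

Lemma empty_ply_edge_le (G : sgraph) (d : drawing R G) (u v w : G) :
  empty_ply d -> adj u v -> u != w ->
  edist (d u) (d v) <= 2 * edist (d u) (d w).
Proof.
move=> ply uv uw.
exact: le_trans (longest_edge_ge d uv) (empty_ply_longest_edge ply uw).
Qed.

End Drawings.

Theorem theorem6 (R : realType) (m : nat) (hm : (15 <= m)%N) :
  ~ exists d : drawing R (complete_bipartite 2 m), empty_ply d.
Proof.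
case=> d ply.
pose hub (k : 'I_2) : complete_bipartite 2 m := inl k.
pose leaf (i : 'I_m) : complete_bipartite 2 m := inr i.
pose L k := longest_edge d (hub k).
pose D k i := edist (d (hub k)) (d (leaf i)).
have hub_le k i : (D k i <= L k <= 2 * D k i)%R.
  by rewrite longest_edge_ge //= empty_ply_longest_edge.
have leaf_hub k k' i : (D k i <= 2 * D k' i)%R.
  by rewrite /D ![edist (d (hub _)) _]edistC empty_ply_edge_le.
have leaf_leaf k i j : i != j ->
    (D k i <= 2 * edist (d (leaf i)) (d (leaf j)))%R.
  by move=> ij; rewrite /D [edist (d (hub _)) _]edistC empty_ply_edge_le.
have m0 : (0 < m)%N by apply: leq_trans hm.
have L_ge0 k : (0 <= L k)%R by apply: bigmax_ge_id.
(* Each edge at [k] ends in a leaf, whose edge to [k'] is at least half as long. *)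
have L2 k k' : (L k <= 2 * L k')%R.
  apply: bigmax_le => [|[//|i] _]; first by rewrite mulr_ge0.
  apply: le_trans (leaf_hub k k' i) _; rewrite ler_pM2l //.
  by case/andP: (hub_le k' i).
have L0 k : (0 < L k)%R.
  apply: lt_le_trans (proj1 (andP (hub_le k (Ordinal m0)))).
  by rewrite edist_gt0 (inj_eq (@pos_inj _ _ d)).
(* The hub with the larger longest edge takes the role of [a]; 14 leaves at most contradict [hm]. *)
have key k k' : k != k' -> (L k' <= L k)%R -> False.
  move=> kk' kL; move: hm.
  rewrite leqNgt -[X in (X < _)%N](card_ord m) ltnS => /negP; apply.
  apply: (@two_hubs_card R _ (d (hub k)) (d (hub k')) (d \o leaf) (L k) (L k')).
  - exact: L0.
  - by rewrite kL L2.
  - by rewrite empty_ply_longest_edge.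
  - exact: hub_le.
  - exact: hub_le.
  - by move=> i; split; apply: leaf_hub.
  - by move=> i j ij; split; apply: leaf_leaf.
have [|/ltW] := lerP (L ord0) (L ord_max); exact: key.
Qed.
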